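(* Let $(X,\mu)$ be a measure space, let $\{H(x):x\in X\}$ be a $\mu$-measurable collection of Hilbert spaces over $\mathbb{F}$ ($\mathbb{F}=\mathbb{R}$ or $\mathbb{F}=\mathbb{C}$), and let $(\varphi_n)_{n=1}^{\infty}$ be an arbitrary orthonormal system in the direct integral $\mathbf{L}_2=\int_X^{\oplus}H(x)\,d\mu(x)$. Let $(a_n)_{n=1}^{\infty}$ be a sequence of numbers in $\mathbb{F}$ and let $(\omega_n)_{n=1}^{\infty}$ be a (nonstrictly) increasing sequence of positive numbers such that $$\sum_{n=2}^{\infty}|a_n|^2\,(\log_2^2 n)\,\omega_n<\infty\qquad\text{and}\qquad \sum_{n=2}^{\infty}\frac{1}{n\,(\log_2 n)\,\omega_n}<\infty .$$ Then the series $\sum_{n=1}^{\infty}a_n\varphi_n(x)$ converges unconditionally $\mu$-a.e. on $X$.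
   Context: $X$ is an arbitrary measurable space with a $\sigma$-additive measure $\mu\ge 0$, not assumed finite or $\sigma$-finite. $\{H(x):x\in X\}$ is a collection of Hilbert spaces, either all real or all complex, of arbitrary dimensions; it is called $\mu$-measurable if the function $x\mapsto\dim H(x)$ takes only finitely or countably many values (cardinal numbers) and all the sets $\{x\in X:\dim H(x)=\mathrm{const}\}$ are $\mu$-measurable. The direct integral $\mathbf{L}_2=\int_X^{\oplus}H(x)\,d\mu(x)$ is the Hilbert space with inner product $(f,g)_2=\int_X(f(x),g(x))_{H(x)}\,d\mu(x)$ and norm $\|\cdot\|_2$. In the standard way: on each set $X_\kappa=\{x:\dim H(x)=\kappa\}$ the spaces $H(x)$ are identified with one fixed Hilbert space $H_\kappa$ of dimension $\kappa$, and $\mathbf{L}_2$ consists of the classes of $\mu$-equivalent functions $f$ on $X$ with $f(x)\in H(x)$, whose restriction to each $X_\kappa$ is a strongly $\mu$-measurable $H_\kappa$-valued function, and with $\|f\|_2^2=\int_X\|f(x)\|_{H(x)}^2\,d\mu(x)<\infty$. In particular, if $H(x)\equiv H$ is constant, then $\mathbf{L}_2=L_2(X,d\mu;H)$, the space of classes of strongly $\mu$-measurable square-integrable functions $f:X\to H$. The series $\sum_{n=1}^{\infty}a_n\varphi_n(x)$ is called unconditionally convergent $\mu$-a.e. on $X$ if, for every permutation $\sigma$ of the set $\mathbb{N}$ of all positive integers, the series $\sum_{n=1}^{\infty}a_{\sigma(n)}\varphi_{\sigma(n)}(x)$ converges in the norm of $H(x)$ for $\mu$-almost every $x\in X$; the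 measure-zero exceptional set may depend on $\sigma$. Notation: $\log_2^2 n=(\log_2 n)^2$. *)

(* Defs.v *)
From HB Require Import structures.
From mathcomp Require Import all_boot all_order all_algebra.
From mathcomp Require Import complex.
From mathcomp Require Import all_classical all_reals all_analysis.
From mathcomp Require Import measurable_realfun.

Set Implicit Arguments.
Unset Strict Implicit.
Unset Printing Implicit Defensive.

Import Order.TTheory GRing.Theory Num.Theory.
Import numFieldNormedType.Exports.

Local Open Scope classical_set_scope.
Local Open Scope ring_scope.

Inductive scalar_kind := RealScalars | ComplexScalars.

Definition scalarField (R : realType) (k : scalar_kind) : numFieldType :=
  match k with RealScalars => R | ComplexScalars => R[i] end.

Definition sconj (R : realType) (k : scalar_kind) : scalarField R k -> scalarField R k :=
  match k with RealScalars => idfun | ComplexScalars => @conjc R end.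

Definition sRe (R : realType) (k : scalar_kind) : scalarField R k -> R :=
  match k with RealScalars => idfun | ComplexScalars => @complex.Re R end.

(* The norm of a normed module over [scalarField R k] takes its values in
   [scalarField R k]; [rnorm] is the same number, seen in R. *)
Definition rnorm (R : realType) (k : scalar_kind)
    (V : normedModType (scalarField R k)) (v : V) : R := sRe `|v|.

Definition scalar_integral (R : realType) (k : scalar_kind) (d : measure_display)
    (X : measurableType d) (mu : {measure set X -> \bar R}) :
    (X -> scalarField R k) -> scalarField R k :=
  match k with
  | RealScalars => fun f => \int[mu]_x (f x)
  | ComplexScalars => fun f =>
      Complex (\int[mu]_x (complex.Re (f x))) (\int[mu]_x (complex.Im (f x)))
  end.

Record hilbertSpace (R : realType) (k : scalar_kind) := HilbertSpace {
  hilbert_sort :> completeNormedModType (scalarField R k);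
  inner : {dot hilbert_sort for @sconj R k};
  sqr_norm_inner : forall u, `|u| ^+ 2 = inner u u
}.

Arguments inner {R k h}.


Section dimension.
Context (R : realType) (k : scalar_kind).
Implicit Types V W : hilbertSpace R k.

(* a complete orthonormal system *)
Definition orthonormal_basis V (B : set V) : Prop :=
  (forall u v, B u -> B v -> inner u v = (u == v)%:R) /\
  (forall v, (forall u, B u -> inner v u = 0) -> v = 0).

(* dim V = dim W, the dimension being the cardinality of an orthonormal
   basis *)
Definition same_dim V W : Prop :=
  exists (B : set V) (C : set W),
    [/\ orthonormal_basis B, orthonormal_basis C & (B #= C)%card].

Definition unitary V W (U : V -> W) : Prop :=
  [/\ linear U, (forall u v, inner (U u) (U v) = inner u v) &
      (forall w, exists v, U v = w)].

End dimension.

Section direct_integral.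
Context (R : realType) (k : scalar_kind) (d : measure_display)
  (X : measurableType d) (mu : {measure set X -> \bar R}).
Implicit Type H : X -> hilbertSpace R k.

(* The mu-measurable sets are those of the mu-completion of the sigma-algebra
   of X. *)
Definition measurable_collection H : Prop :=
  (exists2 D : set X, countable D &
     forall x, exists2 y, D y & same_dim (H y) (H x)) /\
  (forall y, completed_algebra_gen mu [set x | same_dim (H y) (H x)]).

(* The indices i stand for the cardinals kappa, [model i] for the fixed space
   H_kappa. [ident i x] is only meaningful for x in [stratum i], that is,
   X_kappa; making it total avoids transports between the types [H x]. *)
Record identification H := Identification {
  dims : Type;
  model : dims -> hilbertSpace R k;
  model_inj : forall i j, same_dim (model i) (model j) -> i = j;
  model_total : forall x, exists i, same_dim (model i) (H x);
  stratum := fun i => [set x | same_dim (model i) (H x)];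
  ident : forall i x, H x -> model i;
  ident_unitary : forall i x, stratum i x -> unitary (@ident i x)
}.

Definition simple_function (V : normedModType (scalarField R k)) (s : X -> V) :
    Prop :=
  finite_set (range s) /\ forall v, measurable (s @^-1` [set v]).

Definition strongly_measurable_on (V : normedModType (scalarField R k))
    (A : set X) (g : X -> V) : Prop :=
  exists s : nat -> X -> V, (forall n, simple_function (s n)) /\
    {ae mu, forall x, A x -> s n x @[n --> \oo] --> g x}.

(* The elements of the direct integral are the mu-a.e. classes of the f
   satisfying this predicate. *)
Definition in_L2 H (J : identification H) (f : forall x, H x) : Prop :=
  (forall i : dims J,
     strongly_measurable_on (stratum i) (fun x => ident i (f x))) /\
  (\int[mu]_x (rnorm (f x) ^+ 2)%:E < +oo)%E.

Definition inner_L2 H (f g : forall x, H x) : scalarField R k :=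
  scalar_integral mu (fun x => inner (f x) (g x)).

(* Sequences are indexed by the positive integers; the term of index 0 is
   never used. *)
Definition orthonormal_system H (J : identification H)
    (phi : nat -> forall x, H x) : Prop :=
  (forall n, (0 < n)%N -> in_L2 J (phi n)) /\
  (forall m n, (0 < m)%N -> (0 < n)%N ->
     inner_L2 (phi m) (phi n) = (m == n)%:R).

Definition unconditionally_cvg_ae H (u : nat -> forall x, H x) : Prop :=
  forall sigma : nat -> nat,
    set_bij [set n | (0 < n)%N] [set n | (0 < n)%N] sigma ->
    {ae mu, forall x, cvgn (fun N => \sum_(1 <= n < N.+1) u (sigma n) x)}.

End direct_integral.

Definition log2 (R : realType) (x : R) : R := ln x / ln 2.

(* Main.v *)
Require Import Defs.
From HB Require Import structures.
From mathcomp Require Import all_boot all_order all_algebra.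
From mathcomp Require Import complex.
From mathcomp Require Import all_classical all_reals all_analysis.
From mathcomp Require Import measurable_realfun.
From mathcomp Require Import lra ring.

Set Implicit Arguments.
Unset Strict Implicit.
Unset Printing Implicit Defensive.

Import Order.TTheory GRing.Theory Num.Theory.
Import numFieldNormedType.Exports.
Local Open Scope classical_set_scope.
Local Open Scope ring_scope.

(* Split the indices into the blocks 2^2^k <= n < 2^2^(k+1). Within a block, the
   permuted series is an orthogonal series with at most 2^2^(k+1) terms, and the
   Menshov-Rademacher dyadic argument bounds the squared norms of all its
   partial sums by one function M_k whose integral is at most
   (2^(k+1) + 1)^2 times the sum of |a_n|^2 over the block, hence at most
   9 times the sum of |a_n|^2 log2(n)^2. Put w_k = omega(2^2^k). Then
   sum_k w_k M_k has a finite integral, and condensing twice the second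
   hypothesis gives sum_k 1/w_k < oo. Since 2 sqrt(M_k) <= w_k M_k + 1/w_k, the
   sum of the sqrt(M_k) is finite a.e. Any two late enough partial sums of the
   permuted series agree on the first blocks, so they differ by at most a tail
   of 2 sum_k sqrt(M_k). *)

(** * Scalars and norms *)

Section scalars.
Context (R : realType) (k : scalar_kind).
Implicit Types a b : scalarField R k.

Lemma sReD a b : sRe (a + b) = sRe a + sRe b.
Proof. by case: k a b => //= -[? ?] [? ?]. Qed.

Lemma sRe0 : sRe (0 : scalarField R k) = 0.
Proof. by case: k. Qed.

Lemma sReN a : sRe (- a) = - sRe a.
Proof. by case: k a => //= -[]. Qed.

Lemma sRe_sum (I : Type) (s : seq I) (P : pred I) (F : I -> scalarField R k) :
  sRe (\sum_(i <- s | P i) F i) = \sum_(i <- s | P i) sRe (F i).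
Proof. exact: (big_morph _ sReD sRe0). Qed.

Lemma sRe_conj a : sRe (sconj a) = sRe a.
Proof. by case: k a => //= -[]. Qed.

Lemma sRe_le a b : a <= b -> sRe a <= sRe b.
Proof. by case: k a b => //= -[? ?] [? ?] /andP[]. Qed.

(** A nonnegative scalar has imaginary part zero, so the product of imaginary parts vanishes. *)
Lemma sRe_ge0_mul a b : 0 <= a -> sRe (a * b) = sRe a * sRe b.
Proof.
case: k a b => //= -[? ?] [? ?] /andP[/= /eqP -> _].
by rewrite mul0r subr0.
Qed.

Lemma sRe_norm_ge0 a : 0 <= sRe `|a|.
Proof. by rewrite -sRe0 sRe_le. Qed.

Lemma mul_sconj a : a * sconj a = `|a| ^+ 2.
Proof.
case: k a => [a|a]; first by rewrite /= -normrX ger0_norm ?sqr_ge0.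
by rewrite /= sqr_normc.
Qed.

Lemma sRe_gt0 a : 0 < a -> 0 < sRe a.
Proof. by case: k a => //= -[? ?] /andP[]. Qed.

End scalars.

Section hilbert_norm.
Context (R : realType) (k : scalar_kind).

Section normed.
Context (V : normedModType (scalarField R k)).
Implicit Types u v : V.

Lemma rnorm_ge0 u : 0 <= rnorm u.
Proof. by rewrite /rnorm -(normr_id u) sRe_norm_ge0. Qed.

Lemma ler_rnormD u v : rnorm (u + v) <= rnorm u + rnorm v.
Proof. by rewrite /rnorm -sReD sRe_le// ler_normD. Qed.

Lemma rnormB u v : rnorm (u - v) = rnorm (v - u).
Proof. by rewrite /rnorm distrC. Qed.

Lemma rnorm0 : rnorm (0 : V) = 0.
Proof. by rewrite /rnorm normr0 sRe0. Qed.

Lemma rnormZ (a : scalarField R k) u : rnorm (a *: u) = sRe `|a| * rnorm u.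
Proof. by rewrite /rnorm normrZ sRe_ge0_mul. Qed.

(** The order of [R[i]] compares the real parts of scalars with equal imaginary parts; here both are
    zero by nonnegativity. *)
Lemma rnorm_lt u (e : scalarField R k) : 0 < e -> rnorm u < sRe e -> `|u| < e.
Proof.
rewrite /rnorm => e0; have := normr_ge0 u; move: `|u| e0; move: e.
case: k => //= -[e e'] [r r'] /andP[/= /eqP -> _] /andP[/= /eqP -> _] re.
by apply/andP; rewrite /= eqxx.
Qed.

Lemma rnorm_sum (I : Type) (s : seq I) (P : pred I) (F : I -> V) :
  rnorm (\sum_(i <- s | P i) F i) <= \sum_(i <- s | P i) rnorm (F i).
Proof.
elim/big_ind2: _ => [|? ? ? ? h1 h2|//]; first by rewrite rnorm0.
by rewrite (le_trans (ler_rnormD _ _)) ?lerD.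
Qed.

End normed.

Section inner_product.
Context (V : hilbertSpace R k).
Implicit Types u v w : V.

Lemma inner0l v : inner 0 v = 0.
Proof. by rewrite linear0l. Qed.
Lemma innerDl u v w : inner (u + v) w = inner u w + inner v w.
Proof. by rewrite linearDl. Qed.
Lemma innerZl (a : scalarField R k) u w : inner (a *: u) w = a * inner u w.
Proof. by rewrite linearZl_LR. Qed.
Lemma innerC u v : inner u v = sconj (inner v u).
Proof. by have := hermitian_subproof (s := inner) u v; rewrite expr0 mul1r. Qed.

Lemma innerDr u v w : inner u (v + w) = inner u v + inner u w.
Proof. by rewrite linearDr. Qed.

Lemma innerZr (a : scalarField R k) u w : inner u (a *: w) = sconj a * inner u w.
Proof. by rewrite linearZr_LR. Qed.

Lemma inner_suml (I : Type) (s : seq I) (F : I -> V) w :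
  inner (\sum_(i <- s) F i) w = \sum_(i <- s) inner (F i) w.
Proof.
by apply: (big_morph (fun u => inner u w)) => [u v|]; rewrite ?innerDl ?inner0l.
Qed.

Lemma inner_sumr (I : Type) (s : seq I) (F : I -> V) u :
  inner u (\sum_(i <- s) F i) = \sum_(i <- s) inner u (F i).
Proof.
apply: (big_morph (fun w => inner u w)) => [v w|]; rewrite ?innerDr//.
by rewrite linear0r.
Qed.

Lemma rnorm_sqr u : rnorm u ^+ 2 = sRe (inner u u).
Proof. by rewrite -sqr_norm_inner !expr2 sRe_ge0_mul. Qed.

Lemma rnorm_sqrD u v :
  rnorm (u + v) ^+ 2 = rnorm u ^+ 2 + rnorm v ^+ 2 + 2 * sRe (inner u v).
Proof.
rewrite !rnorm_sqr innerDl !innerDr !sReD (innerC v u) sRe_conj; ring.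
Qed.

Lemma inner_eq0 u : inner u u = 0 -> u = 0.
Proof.
rewrite -sqr_norm_inner => /eqP.
by rewrite expf_eq0 /= => /eqP/normr0_eq0.
Qed.

End inner_product.
End hilbert_norm.

(** * Integrals up to null sets *)

Section scalar_topology.
Context (R : realType) (k : scalar_kind).

Lemma sRe_lt (a b : scalarField R k) : a < b -> sRe a < sRe b.
Proof. by move=> ab; rewrite -subr_gt0 -sReN -sReD sRe_gt0// subr_gt0. Qed.

Lemma sRe_surj_gt0 (e : R) : 0 < e ->
  exists2 a : scalarField R k, 0 < a & sRe a = e.
Proof.
case: k => e0; first by exists e.
by exists (Complex e 0) => //; rewrite ltcE/= eqxx.
Qed.

Lemma cvg_rnorm (V : normedModType (scalarField R k)) (u : nat -> V) (l : V) :
  u n @[n --> \oo] --> l -> rnorm (u n) @[n --> \oo] --> rnorm l.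
Proof.
move=> ul; apply/cvgrPdist_lt => e /sRe_surj_gt0[a a0 <-].
move/cvgrPdist_lt : ul => /(_ _ a0); apply: filterS => n /sRe_lt.
apply: le_lt_trans; rewrite -/(rnorm _) ler_norml.
have := ler_rnormD (l - u n) (u n); rewrite subrK.
have := ler_rnormD (u n - l) l; rewrite subrK (rnormB (u n) l).
lra.
Qed.

End scalar_topology.

Section conull_sets.
Context (R : realType) (d : measure_display) (X : measurableType d)
  (mu : {measure set X -> \bar R}).
Import HBNNSimple.

(** Strong measurability and the strata are only given up to null sets. Restricting functions to
    such a [D] makes them measurable for the original sigma-algebra, with no passage to the
    completed measure. *)
Definition conull (D : set X) := measurable D /\ mu (~` D) = 0%E.

Lemma conull_ae (D : set X) (P : X -> Prop) :
  conull D -> (forall x, D x -> P x) -> {ae mu, forall x, P x}.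
Proof.
move=> [mD D0] DP; exists (~` D); split => //; first exact: measurableC.
by move=> x /= nP Dx; apply: nP; exact: DP.
Qed.

Lemma conull_bigcap (D : nat -> set X) :
  (forall n, conull (D n)) -> conull (\bigcap_n D n).
Proof.
move=> cD; split; first by apply: bigcapT_measurable => n; case: (cD n).
rewrite setC_bigcap; apply/negligibleP; last first.
  apply: negligible_bigcup => n; have [mD D0] := cD n.
  by exists (~` D n); split => //; exact: measurableC.
by apply: bigcup_measurable => n _; apply: measurableC; case: (cD n).
Qed.

(* [f] need not be measurable: its integral is a supremum over the simple
   functions below it. *)
Lemma ge0_integral_conull (D : set X) (f : X -> \bar R) :
  conull D -> (forall x, (0 <= f x)%E) ->
  (\int[mu]_x f x = \int[mu]_(x in D) f x)%E.
Proof.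
move=> [mD D0] f0; rewrite integral_mkcond [RHS]integral_mkcond patch_setT.
have fD0 x : (0 <= (f \_ D) x)%E by rewrite patchE; case: ifP.
rewrite (ge0_integralTE _ f0) (ge0_integralTE _ fD0); apply/eqP.
rewrite eq_le; apply/andP; split; apply: ge_ereal_sup => _ [h /= hf <-].
  (* A simple function below [f], set to 0 outside [D], keeps its integral because the complement of
     [D] is null. *)
  apply: le_ereal_sup_tmp; exists (sintegral mu (proj_nnsfun h mD)).
    exists (proj_nnsfun h mD) => //= x; rewrite patchE /mindic indicE.
    by case: (x \in D); rewrite ?mulr1// mulr0.
  rewrite -!integralT_nnsfun.
  have mh : measurable_fun [set: X] (EFin \o h) by exact/measurable_EFinP.
  rewrite (@ge0_negligible_integral _ _ _ mu _ (~` D) (EFin \o h))//; last first.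
  - by move=> x _; rewrite lee_fin.
  - exact: measurableC.
  rewrite setTD setCK integral_mkcond le_eqVlt; apply/orP; left.
  apply/eqP/eq_integral => x _.
  by rewrite patchE/= /mindic indicE; case: (x \in D); rewrite ?mulr1// mulr0.
apply: ereal_sup_ubound; exists h => //= x; rewrite (le_trans (hf x))//.
by rewrite patchE; case: ifP.
Qed.

Lemma integral_conull (D : set X) (f : X -> \bar R) :
  conull D -> (\int[mu]_x f x = \int[mu]_(x in D) f x)%E.
Proof.
move=> cD; rewrite integralE [RHS]integralE.
by congr (_ - _)%E; exact: ge0_integral_conull.
Qed.

End conull_sets.

Section strong_measurability.
Context (R : realType) (k : scalar_kind) (d : measure_display)
  (X : measurableType d) (mu : {measure set X -> \bar R})
  (V : normedModType (scalarField R k)).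

(** [F] can be arbitrary: every preimage is a finite union of intersections of level sets of [s] and
    [t]. *)
Lemma measurable_simple2 (s t : X -> V) (F : V -> V -> R) :
  simple_function s -> simple_function t ->
  measurable_fun setT (fun x => F (s x) (t x)).
Proof.
move=> [fs ms] [ft mt] _ Y mY; rewrite setTI.
rewrite [X in measurable X](_ : _ =
  \bigcup_(v in (range s `*` range t) `&` [set v | Y (F v.1 v.2)])
    (s @^-1` [set v.1] `&` t @^-1` [set v.2])); last first.
  apply/seteqP; split => [x Yx|x [[v w] [_ /= Yvw] [/= -> ->]]] //.
  exists (s x, t x) => //; split => //; split; by exists x.
apply: fin_bigcup_measurable; first exact/finite_setIl/finite_setX.
by move=> v _; exact: measurableI.
Qed.

(** Up to a null set [A] is a measurable [A']. Removing measurable null sets [S] and [T] that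
    contain the points of nonconvergence leaves a set where the norm is a pointwise limit of
    measurable functions. *)
Lemma strongly_measurable_rnorm (A : set X) (g h : X -> V)
    (a b : scalarField R k) :
  completed_algebra_gen mu A ->
  strongly_measurable_on mu A g -> strongly_measurable_on mu A h ->
  exists B, [/\ measurable B, mu.-negligible (A `\` B), B `<=` A &
    measurable_fun B (fun x => rnorm (a *: g x + b *: h x))].
Proof.
move=> [A' mA' [N nN <-]] [s [ss [S [mS S0 sg]]]] [t [st [T [mT T0 th]]]].
have mB : measurable (A' `\` (S `|` T)).
  by apply: measurableD => //; exact: measurableU.
exists (A' `\` (S `|` T)); split => //.
- apply: (@negligibleS _ _ _ _ (N `|` (S `|` T))).
    move=> x [[A'x|Nx] nB]; last by left.
    right; apply: contrapT => nST; apply: nB; split => //.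
  apply: negligibleU => //; apply: negligibleU.
  + by exists S; split.
  + by exists T; split.
- by move=> x []; left.
apply: (@measurable_fun_cvg _ _ _ _ (fun n x => rnorm (a *: s n x + b *: t n x))).
  move=> n; apply: (@measurable_funS _ _ _ _ setT) => //.
  exact: (@measurable_simple2 (s n) (t n) (fun v w => rnorm (a *: v + b *: w))).
move=> x [A'x /not_orP[nSx nTx]]; apply: cvg_rnorm.
have sgx : s n x @[n --> \oo] --> g x.
  apply: contrapT => nc; apply: nSx; apply: sg => /= cx.
  by apply: nc; apply: cx; left.
have thx : t n x @[n --> \oo] --> h x.
  apply: contrapT => nc; apply: nTx; apply: th => /= cx.
  by apply: nc; apply: cx; left.
by apply: cvgD; apply: cvgZl_tmp.
Qed.

End strong_measurability.

(** * Measurability in the direct integral *)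

Section unitary_maps.
Context (R : realType) (k : scalar_kind).
Implicit Types V W : hilbertSpace R k.

Lemma unitary_inj V W (U : V -> W) : unitary U -> injective U.
Proof.
move=> [lU iU _] u v Uuv; apply/subr0_eq/inner_eq0; rewrite -iU.
suff -> : U (u - v) = 0 by rewrite inner0l.
by rewrite addrC -scaleN1r lU Uuv scaleN1r addNr.
Qed.

Lemma unitary_basis V W (U : V -> W) (B : set V) :
  unitary U -> orthonormal_basis B -> orthonormal_basis (U @` B).
Proof.
move=> uU [Bon Bc]; have Uinj := unitary_inj uU; case: uU => lU iU sU.
split=> [_ _ [u Bu <-] [v Bv <-]|w h]; first by rewrite iU Bon// (inj_eq Uinj).
have [v Uv] := sU w; rewrite -Uv.
have -> : v = 0.
  by apply: Bc => u Bu; rewrite -iU Uv h//; exists u.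
(* This instance of linearity gives [U 0 = 0]. *)
by have := lU (-1) 0 0; rewrite scaleN1r addNr scaleN1r addNr.
Qed.

Lemma same_dim_unitary V V' W W' (U : V -> V') (T : W -> W') :
  unitary U -> unitary T -> same_dim V W -> same_dim V' W'.
Proof.
move=> uU uT [B [C [hB hC BC]]]; exists (U @` B), (T @` C); split.
- exact: unitary_basis.
- exact: unitary_basis.
- rewrite (card_eql (inj_card_eq (in2W (unitary_inj uU)))).
  by rewrite (card_eqr (inj_card_eq (in2W (unitary_inj uT)))).
Qed.

Lemma unitary_rnorm V W (U : V -> W) v : unitary U -> rnorm (U v) = rnorm v.
Proof.
move=> [_ iU _]; apply: (pexpIrn (n := 2)); rewrite ?nnegrE ?rnorm_ge0//.
by rewrite !rnorm_sqr iU.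
Qed.

End unitary_maps.

Section direct_integral_measurability.
Context (R : realType) (k : scalar_kind) (d : measure_display)
  (X : measurableType d) (mu : {measure set X -> \bar R})
  (H : X -> hilbertSpace R k) (J : identification H).

(* Transitivity of [same_dim] would require comparing two bases of one space;
   [model_inj] does it instead, after transporting bases to the models. *)
Lemma stratum_same_dim (i : dims J) x y :
  stratum i y -> same_dim (H y) (H x) -> stratum i x.
Proof.
move=> iy yx; have [j jx] := model_total J x.
suff -> : i = j by [].
apply: model_inj.
exact: same_dim_unitary (ident_unitary iy) (ident_unitary jx) yx.
Qed.

Hypothesis HM : measurable_collection mu H.

(** On one stratum the norm is computed in the fixed model space, where strong measurability
    applies; countably many strata are then glued together. *)
Lemma L2_rnorm_measurable (f g : forall x, H x) (a b : scalarField R k) :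
  in_L2 mu J f -> in_L2 mu J g ->
  exists2 D, conull mu D &
    measurable_fun D (fun x => rnorm (a *: f x + b *: g x)).
Proof.
move=> [sf _] [sg _]; have [[Y /countable_injP[F Finj] YH] mH] := HM.
(* [F] numbers the representatives in [Y]; [E n] is the stratum of the one with number [n], and is
   empty if there is none. *)
pose E n := [set x | exists y, [/\ Y y, F y = n & same_dim (H y) (H x)]].
have /choice[B hB] n : exists B, [/\ measurable B, mu.-negligible (E n `\` B) &
    measurable_fun B (fun x => rnorm (a *: f x + b *: g x))].
  have [[y [Yy Fy]]|nY] := pselect (exists y, Y y /\ F y = n); last first.
    exists set0; split => //; last exact: measurable_fun_set0.
    rewrite setD0 (_ : E n = set0)//; first exact: negligible_set0.
    by rewrite -subset0 => x [y [Yy Fy _]]; apply: nY; exists y.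
  have [i iy] := model_total J y.
  have EE : E n = [set x | same_dim (H y) (H x)].
    apply/seteqP; split => x; last by move=> h; exists y.
    move=> [y' [Yy' Fy' h]]; suff -> : y = y' by [].
    by apply: Finj; rewrite ?inE// Fy.
  have EJ : E n `<=` stratum i by rewrite EE => x; exact: stratum_same_dim.
  have sm (h : forall x, H x) : strongly_measurable_on mu (stratum i)
      (fun x => ident i (h x)) ->
      strongly_measurable_on mu (E n) (fun x => ident i (h x)).
    move=> [s [ss ch]]; exists s; split => //.
    by apply: filterS ch => x + /EJ.
  have cE : completed_algebra_gen mu (E n) by rewrite EE.
  have [B [mB nB BE mfB]] :=
    strongly_measurable_rnorm a b cE (sm _ (sf i)) (sm _ (sg i)).
  exists B; split => //; apply: eq_measurable_fun mfB => x /[!inE] /BE/EJ xi.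
  have uU := ident_unitary xi; rewrite -(unitary_rnorm _ uU).
  have [lU _ _] := uU; congr rnorm; rewrite lU; congr (_ + _).
  have := lU b (g x) 0; rewrite addr0 => ->.
  have /eqP := lU 1 0 0.
  by rewrite !scale1r addr0 -subr_eq0 opprD addNKr oppr_eq0 => /eqP ->; rewrite addr0.
exists (\bigcup_n B n); last first.
  by apply/measurable_fun_bigcup => n; have [] := hB n.
have mB : measurable (\bigcup_n B n).
  by apply: bigcupT_measurable => n; have [] := hB n.
split => //; apply/negligibleP; first exact: measurableC.
(* The sets [E n] cover [X], so a point outside every [B n] lies in some null difference. *)
apply: (@negligibleS _ _ _ _ (\bigcup_n (E n `\` B n))).
  move=> x nBx; have [y Yy yx] := YH x; exists (F y) => //; split.
    by exists y.
  by move=> Bx; apply: nBx; exists (F y).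
by apply: negligible_bigcup => n; have [] := hB n.
Qed.

End direct_integral_measurability.

(** * Integrals of inner products *)

Section conull_integrals.
Context (R : realType) (d : measure_display) (X : measurableType d)
  (mu : {measure set X -> \bar R}).

Lemma conullI (D E : set X) : conull mu D -> conull mu E -> conull mu (D `&` E).
Proof.
move=> [mD D0] [mE E0]; split; first exact: measurableI.
by rewrite setCI; apply: null_set_setU => //; exact: measurableC.
Qed.

Lemma measurable_conullS (D E : set X) (f : X -> R) :
  conull mu D -> E `<=` D -> measurable_fun D f -> measurable_fun E f.
Proof. by move=> [mD _]; exact: measurable_funS. Qed.

(** In the complex case the factors 1 and -i turn the hypothesis into integrability of the real and
    imaginary parts of [w]; then Re(c w) = Re c Re w - Im c Im w is integrated termwise. *)
Lemma scalar_integral_sRe (k : scalar_kind) (w : X -> scalarField R k)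
    (c : scalarField R k) :
  (forall e, exists2 D, conull mu D &
     mu.-integrable D (EFin \o (fun x => sRe (e * w x)))) ->
  (\int[mu]_x (sRe (c * w x))%:E = (sRe (c * scalar_integral mu w))%:E)%E.
Proof.
case: k w c => /= w c int_im.
  have [D cD iw] := int_im 1; rewrite (integral_conull _ cD).
  under eq_integral do rewrite EFinM.
  have [mD _] := cD; have {}iw : mu.-integrable D (fun x => (w x)%:E).
    by under eq_fun do rewrite -[w _]mul1r.
  rewrite integralZl// EFinM /Rintegral (integral_conull _ cD) fineK//.
  exact: integrable_fin_num.
have [D cD iD] := int_im 1; have [E cE iE] := int_im (Complex 0 (-1)).
have cDE := conullI cD cE; have [mDE _] := cDE.
have {iD}iR : mu.-integrable (D `&` E) (fun x => (complex.Re (w x))%:E).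
  under eq_fun do rewrite -[w _]mul1r.
  by apply: integrableS iD => //; case: cD.
have {iE}iI : mu.-integrable (D `&` E) (fun x => (complex.Im (w x))%:E).
  have -> : (fun x => (complex.Im (w x))%:E) = 
     (EFin \o (fun x => complex.Re (Complex 0 (-1) * w x))).
    by apply/funext => x /=; case: (w x) => ? ? /=; rewrite mul0r sub0r mulN1r opprK.
  by apply: integrableS iE => //; case: cE.
rewrite /Rintegral !(integral_conull _ cDE); case: c => [p q] /=.
rewrite (_ : (fun x => _) = (fun x =>
    p%:E * (complex.Re (w x))%:E - q%:E * (complex.Im (w x))%:E)%E); last first.
  by apply/funext => x; rewrite -!EFinM -EFinB; case: (w x).
rewrite integralB//=; try exact: integrableZl.
by rewrite !integralZl// EFinB !EFinM !fineK// integrable_fin_num.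
Qed.

End conull_integrals.

Section L2_inner_product.
Context (R : realType) (k : scalar_kind) (d : measure_display)
  (X : measurableType d) (mu : {measure set X -> \bar R})
  (H : X -> hilbertSpace R k) (J : identification H).
Hypothesis HM : measurable_collection mu H.
Implicit Types (f g : forall x, H x) (c : scalarField R k).

(** The zero coefficients give all three norms the shape treated by [L2_rnorm_measurable]. *)
Lemma sRe_inner_polar (V : hilbertSpace R k) (u v : V) c :
  sRe (c * inner u v) =
  (rnorm (c *: u + 1 *: v) ^+ 2 - rnorm (c *: u + 0 *: v) ^+ 2
    - rnorm (0 *: u + 1 *: v) ^+ 2) / 2.
Proof.
by rewrite !scale0r scale1r addr0 add0r rnorm_sqrD innerZl; lra.
Qed.

(* Polarization reduces the inner product to norms. *)
Lemma L2_inner_measurable f g c : in_L2 mu J f -> in_L2 mu J g ->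
  exists2 D, conull mu D &
    measurable_fun D (fun x => sRe (c * inner (f x) (g x))).
Proof.
move=> Lf Lg; have [D cD mD] := L2_rnorm_measurable HM c 1 Lf Lg.
have [E cE mE] := L2_rnorm_measurable HM c 0 Lf Lg.
have [F cF mF] := L2_rnorm_measurable HM 0 1 Lf Lg.
have cDE := conullI cD cE; have cDEF := conullI cDE cF.
exists (D `&` E `&` F) => //.
under eq_fun do rewrite sRe_inner_polar.
apply: measurable_funM => //; apply: measurable_funB.
  apply: measurable_funB; apply: measurable_funX.
    by apply: (measurable_conullS cD _ mD) => x [[]].
  by apply: (measurable_conullS cE _ mE) => x [[]].
by apply: measurable_funX; apply: (measurable_conullS cF _ mF) => x [].
Qed.

(** Expanding the squared norms of [c *: u + v] and [- c *: u + v], both nonnegative, bounds even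
    twice the left side. The bound serves as integrable majorant. *)
Lemma sRe_inner_le (V : hilbertSpace R k) (u v : V) c :
  `|sRe (c * inner u v)| <= sRe `|c| ^+ 2 * rnorm u ^+ 2 + rnorm v ^+ 2.
Proof.
have h1 := rnorm_sqrD (c *: u) v; have h2 := rnorm_sqrD (- c *: u) v.
have p1 := sqr_ge0 (rnorm (c *: u + v)).
have p2 := sqr_ge0 (rnorm (- c *: u + v)).
have p3 := sqr_ge0 (rnorm (c *: u)); have p4 := sqr_ge0 (rnorm v).
move: h1 h2; rewrite !innerZl !rnormZ normrN mulNr sReN !exprMn in p3 *.
by rewrite ler_norml => h1 h2; lra.
Qed.

Lemma L2_inner_integrable f g c : in_L2 mu J f -> in_L2 mu J g ->
  exists2 D, conull mu D &
    mu.-integrable D (EFin \o (fun x => sRe (c * inner (f x) (g x)))).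
Proof.
move=> Lf Lg; have [D cD mD] := L2_inner_measurable c Lf Lg.
have [E cE mE] := L2_inner_measurable 1 Lf Lf.
have [F cF mF] := L2_inner_measurable 1 Lg Lg.
have cDE := conullI cD cE; have cDEF := conullI cDE cF.
have sq (h : forall x, H x) :
    (fun x => sRe (1 * inner (h x) (h x))) = (fun x => rnorm (h x) ^+ 2).
  by apply/funext => x; rewrite mul1r rnorm_sqr.
have sqi (h : forall x, H x) (A : set X) : in_L2 mu J h -> conull mu A ->
    measurable_fun A (fun x => sRe (1 * inner (h x) (h x))) ->
    mu.-integrable A (EFin \o (fun x => rnorm (h x) ^+ 2)).
  rewrite (sq h) => -[_ hoo] cA mA; apply/integrableP; split.
    exact/measurable_EFinP.
  rewrite -(integral_conull _ cA); apply: le_lt_trans hoo.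
  rewrite le_eqVlt; apply/orP; left; apply/eqP/eq_integral => x _ /=.
  by rewrite ger0_norm ?sqr_ge0.
exists (D `&` E `&` F) => //; have [mDEF _] := cDEF.
apply: (@le_integrable _ _ _ _ _ _ _
  (fun x => (sRe `|c| ^+ 2)%:E * (rnorm (f x) ^+ 2)%:E
    + (rnorm (g x) ^+ 2)%:E)%E) => //.
- apply/measurable_EFinP.
  by apply: (measurable_conullS cD _ mD) => x [[]].
- move=> x _ /=; rewrite lee_fin (le_trans (sRe_inner_le _ _ _))//.
  exact: ler_norm.
- apply: integrableD => //.
    apply: integrableZl => //; apply: sqi => //.
    by apply: (measurable_conullS cE _ mE) => x [[]].
  by apply: sqi => //; apply: (measurable_conullS cF _ mF) => x [].
Qed.

Lemma L2_inner_integral f g c : in_L2 mu J f -> in_L2 mu J g ->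
  (\int[mu]_x (sRe (c * inner (f x) (g x)))%:E
    = (sRe (c * inner_L2 mu f g))%:E)%E.
Proof.
by move=> Lf Lg; apply: scalar_integral_sRe => e; exact: L2_inner_integrable.
Qed.

End L2_inner_product.

(** * The Menshov-Rademacher inequality *)

Lemma integral_sum_seq (R : realType) (d : measure_display)
    (X : measurableType d) (mu : {measure set X -> \bar R}) (D : set X)
    (mD : measurable D) (I : eqType) (s : seq I) (f : I -> X -> \bar R) :
  (forall i, i \in s -> mu.-integrable D (f i)) ->
  mu.-integrable D (fun x => \sum_(i <- s) f i x)%E /\
  (\int[mu]_(x in D) \sum_(i <- s) f i x
    = \sum_(i <- s) \int[mu]_(x in D) f i x)%E.
Proof.
elim: s => [|i s IH] hf.
  under eq_fun do rewrite big_nil.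
  by rewrite big_nil integral0; split => //; exact: integrable0.
have fi : mu.-integrable D (f i) by apply: hf; rewrite inE eqxx.
have [|is' es'] := IH; first by move=> j js; apply: hf; rewrite inE js orbT.
under eq_fun do rewrite big_cons.
by rewrite big_cons integralD// es'; split => //; exact: integrableD.
Qed.

Section orthogonal_series.
Context (R : realType) (k : scalar_kind) (d : measure_display)
  (X : measurableType d) (mu : {measure set X -> \bar R})
  (H : X -> hilbertSpace R k) (J : identification H).
Hypothesis HM : measurable_collection mu H.
Context (phi : nat -> forall x, H x) (a : nat -> scalarField R k).
Hypothesis phi_on : orthonormal_system mu J phi.

Definition psum (s : seq nat) (x : X) : H x := \sum_(n <- s) a n *: phi n x.

Lemma psum_cat s t x : psum (s ++ t) x = psum s x + psum t x.
Proof. by rewrite /psum big_cat. Qed.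

Lemma sRe_inner_terms m n x :
  sRe (inner (a m *: phi m x) (a n *: phi n x)) =
  sRe (a m * sconj (a n) * inner (phi m x) (phi n x)).
Proof. by rewrite innerZl innerZr mulrA. Qed.

(** The point is a single [D] for all pairs: the pairs are enumerated by [unpickle] and countably
    many conull sets are intersected. *)
Lemma terms_gram : exists2 D, conull mu D & forall m n, (0 < m)%N -> (0 < n)%N ->
  mu.-integrable D (fun x => (sRe (inner (a m *: phi m x) (a n *: phi n x)))%:E) /\
  (\int[mu]_(x in D) (sRe (inner (a m *: phi m x) (a n *: phi n x)))%:E
    = (sRe `|a n| ^+ 2 * (m == n)%:R)%:E)%E.
Proof.
have [phiL2 phi1] := phi_on.
have /choice[D hD] p : exists D, conull mu D /\ forall m n,
    unpickle p = Some (m, n) -> (0 < m)%N -> (0 < n)%N ->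
    mu.-integrable D
      (fun x => (sRe (inner (a m *: phi m x) (a n *: phi n x)))%:E).
  case E : (unpickle p) => [[m n]|]; last first.
    by exists setT; split => //; split => //; rewrite setCT measure0.
  case: (posnP m) => [->|m0].
    by exists setT; split => [|? ? [<-]//]; split => //; rewrite setCT measure0.
  case: (posnP n) => [->|n0].
    by exists setT; split => [|? ? [_ <-]//]; split => //; rewrite setCT measure0.
  have [D cD iD] :=
    L2_inner_integrable HM (a m * sconj (a n)) (phiL2 _ m0) (phiL2 _ n0).
  exists D; split => // _ _ [<- <-] _ _.
  by under eq_fun do rewrite sRe_inner_terms.
have cD : conull mu (\bigcap_p D p) by apply: conull_bigcap => p; have [] := hD p.
exists (\bigcap_p D p) => // m n m0 n0; split.
  have [[mD _] iD] := hD (pickle (m, n)).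
  apply: integrableS (iD m n (pickleK _) m0 n0) => //; first by case: cD.
  exact: bigcap_inf.
rewrite -(integral_conull _ cD).
under eq_integral do rewrite sRe_inner_terms.
rewrite (L2_inner_integral HM _ (phiL2 _ m0) (phiL2 _ n0)).
rewrite phi1//; case: eqVneq => [->|_]; last by rewrite !mulr0 sRe0.
by rewrite !mulr1 mul_sconj !expr2 sRe_ge0_mul.
Qed.

(** Pythagoras: the square expands into a double sum whose off-diagonal terms integrate to 0. *)
Lemma psum_integral : exists2 D, conull mu D &
  forall s, uniq s -> all (leq 1) s ->
  mu.-integrable D (fun x => (rnorm (psum s x) ^+ 2)%:E) /\
  (\int[mu]_(x in D) (rnorm (psum s x) ^+ 2)%:E
    = (\sum_(n <- s) sRe `|a n| ^+ 2)%:E)%E.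
Proof.
have [D cD hD] := terms_gram; exists D => // s us /allP s0.
have [mD _] := cD.
have -> : (fun x => (rnorm (psum s x) ^+ 2)%:E) = (fun x => \sum_(m <- s)
    \sum_(n <- s) (sRe (inner (a m *: phi m x) (a n *: phi n x)))%:E)%E.
  apply/funext => x; rewrite rnorm_sqr inner_suml sRe_sum -sumEFin.
  by apply: eq_bigr => m _; rewrite inner_sumr sRe_sum -sumEFin.
have gi m n : m \in s -> n \in s -> _ := fun ms ns => hD m n (s0 m ms) (s0 n ns).
have im m : m \in s -> mu.-integrable D (fun x =>
      \sum_(n <- s) (sRe (inner (a m *: phi m x) (a n *: phi n x)))%:E)%E /\
    (\int[mu]_(x in D)
      \sum_(n <- s) (sRe (inner (a m *: phi m x) (a n *: phi n x)))%:E
      = (sRe `|a m| ^+ 2)%:E)%E.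
  move=> ms; have [] := @integral_sum_seq _ _ _ mu D mD _ s (fun n x =>
    (sRe (inner (a m *: phi m x) (a n *: phi n x)))%:E).
    by move=> n ns; have [] := gi m n ms ns.
  move=> i1 e1; split=> //; rewrite e1 (bigD1_seq m)//=.
  rewrite big_seq_cond big1 => [|n /andP[ns nm]].
    by rewrite adde0; have [_ ->] := gi m m ms ms; rewrite eqxx mulr1.
  by have [_ ->] := gi m n ms ns; rewrite eq_sym (negbTE nm) mulr0.
have [|i1 ->] := @integral_sum_seq _ _ _ mu D mD _ s (fun m x =>
  \sum_(n <- s) (sRe (inner (a m *: phi m x) (a n *: phi n x)))%:E)%E.
  by move=> m /im[].
split=> //; rewrite -sumEFin big_seq_cond [RHS]big_seq_cond.
by apply: eq_bigr => m; rewrite andbT => /im[].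
Qed.

(* The sum of the squared norms over all the dyadic pieces of [s]: a prefix of
   [s] is a union of at most one piece of each of the [p + 1] sizes. *)
Fixpoint rademacher (p : nat) (s : seq nat) (x : X) : R :=
  rnorm (psum s x) ^+ 2 +
  if p is p'.+1 then
    rademacher p' (take (2 ^ p') s) x + rademacher p' (drop (2 ^ p') s) x
  else 0.

Lemma rademacher_ge p s x : rnorm (psum s x) ^+ 2 <= rademacher p s x.
Proof.
elim: p s => [|p IH] s /=; rewrite lerDl//.
by rewrite addr_ge0//; apply: le_trans (IH _); rewrite sqr_ge0.
Qed.

Lemma rademacher_ge0 p s x : 0 <= rademacher p s x.
Proof. by apply: le_trans (rademacher_ge _ _ _); rewrite sqr_ge0. Qed.

(** A prefix reaching past the middle is the whole first half plus a prefix of the second half. With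
    c = p + 1, the inequality (e + f)^2 <= (1 + c)(e^2 + f^2 / c) raises the factor only from c to c
    + 1. *)
Lemma rademacher_prefix p s m x : (size s <= 2 ^ p)%N ->
  rnorm (psum (take m s) x) ^+ 2 <= p.+1%:R * rademacher p s x.
Proof.
elim: p s m => [|p IH] s m ss.
  rewrite mul1r; case: m => [|m].
    by rewrite take0 /psum big_nil rnorm0 expr0n rademacher_ge0.
  rewrite take_oversize ?rademacher_ge// (leq_trans ss)//.
set A := rademacher p (take (2 ^ p) s) x.
set B := rademacher p (drop (2 ^ p) s) x.
have A0 : 0 <= A by exact: rademacher_ge0.
have B0 : 0 <= B by exact: rademacher_ge0.
suff h : rnorm (psum (take m s) x) ^+ 2 <= p.+2%:R * (A + B).
  by apply: (le_trans h); rewrite ler_wpM2l//= lerDr sqr_ge0.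
have [mp|pm] := leqP m (2 ^ p).
  have /IH : (size (take (2 ^ p) s) <= 2 ^ p)%N by rewrite size_take_min geq_minl.
  move=> /(_ m); rewrite take_takel// -/A => h; apply: (le_trans h).
  by rewrite ler_pM ?lerDl// ler_nat.
have -> : take m s = take (2 ^ p) s ++ take (m - 2 ^ p) (drop (2 ^ p) s).
  rewrite take_drop subnK ?(ltnW pm)//.
  by rewrite -{1}(take_takel s (ltnW pm)) cat_take_drop.
rewrite psum_cat.
have hA := rademacher_ge p (take (2 ^ p) s) x; rewrite -/A in hA.
have /IH : (size (drop (2 ^ p) s) <= 2 ^ p)%N.
  by rewrite size_drop leq_subLR addnn -mul2n -expnS.
move=> /(_ (m - 2 ^ p)%N); rewrite -/B => hB.
set v := psum _ _ in hA *; set w := psum _ _ in hB *.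
have vw := ler_rnormD v w; have v0 := rnorm_ge0 v; have w0 := rnorm_ge0 w.
have vw0 := rnorm_ge0 (v + w).
have c0 : 0 < p.+1%:R :> R by rewrite ltr0n.
rewrite (natrD _ 1 p.+1) in hB *.
move: (rnorm v) (rnorm w) (rnorm (v + w)) (p.+1%:R : R) vw v0 w0 vw0 c0 hA hB.
move=> e f g c efg e0 f0 g0 c0 hA hB.
have h1 : g ^+ 2 <= (e + f) ^+ 2 by rewrite ler_pXn2r ?nnegrE ?addr_ge0.
(* (1 + c) (e^2 + f^2 / c) - (e + f)^2 = (c e - f)^2 / c *)
rewrite -(ler_pM2l c0).
have h2 := sqr_ge0 (c * e - f).
nra.
Qed.

(** The pieces of each of the [p + 1] levels partition [s], so each level contributes the full sum
    of the squared coefficients. *)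
Lemma rademacher_integral : exists2 D, conull mu D &
  forall p s, uniq s -> all (leq 1) s ->
  mu.-integrable D (fun x => (rademacher p s x)%:E) /\
  (\int[mu]_(x in D) (rademacher p s x)%:E
    = (p.+1%:R * \sum_(n <- s) sRe `|a n| ^+ 2)%:E)%E.
Proof.
have [D cD hD] := psum_integral; exists D => // p.
have [mD _] := cD.
elim: p => [|p IH] s us s0.
  by rewrite mul1r /=; under eq_fun do rewrite addr0; exact: hD.
have [i1 e1] := hD _ us s0.
have [|i2 e2] := IH (take (2 ^ p) s) (take_uniq _ us).
  by apply/allP => n /mem_take; exact/allP.
have [|i3 e3] := IH (drop (2 ^ p) s) (drop_uniq _ us).
  by apply/allP => n /mem_drop; exact/allP.
have i23 := integrableD mD i2 i3.
split.
  under eq_fun do rewrite !EFinD.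
  exact: integrableD.
under eq_integral do rewrite !EFinD.
rewrite integralD// integralD// e1 e2 e3 -!EFinD; congr (_%:E).
rewrite -mulrDr -big_cat cat_take_drop -[p.+2]addn1 natrD; ring.
Qed.

End orthogonal_series.

(** * Double exponential blocks *)

Section double_exponential_blocks.
Context (R : realType).
Local Notation log n := (log2 (n%:R : R)).

(* [trunc_log 2 0 = 0], so [n = 1] belongs to block 0, together with 2 and 3. *)
Definition block (n : nat) : nat := trunc_log 2 (trunc_log 2 n).

Lemma block_bounds n : (0 < n)%N ->
  (n < 2 ^ 2 ^ (block n).+1)%N && ((1 < n)%N ==> (2 ^ 2 ^ block n <= n)%N).
Proof.
move=> n0; have /andP[tn nt] := @trunc_log_bounds 2 n isT n0.
rewrite /block; set t := trunc_log 2 n in tn nt *.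
have [t0|t0] := posnP t.
  by rewrite t0 in nt *; case: n nt {tn n0 t t0} => [|[|[]]].
have /andP[kt tk] := @trunc_log_bounds 2 t isT t0.
apply/andP; split; first by rewrite (leq_trans nt)// leq_exp2l.
by apply/implyP => _; rewrite (leq_trans _ tn)// leq_exp2l.
Qed.

Lemma ln2_gt0 : 0 < ln (2 : R).
Proof. by rewrite ln_gt0// ltr1n. Qed.

Lemma log2_exp j : log (2 ^ j)%N = j%:R.
Proof.
by rewrite /log2 natrX lnXn// -[_ *+ j]mulr_natl mulfK// gt_eqF// ln2_gt0.
Qed.

Lemma ler_log2 m n : (0 < m)%N -> (m <= n)%N -> log m <= log n.
Proof.
move=> m0 mn; rewrite /log2 ler_pM2r ?invr_gt0 ?ln2_gt0//.
by rewrite ler_ln ?posrE ?ltr0n ?ler_nat// (leq_trans m0).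
Qed.

(** First condensation: there are 2^j terms, each at least 1 / (2^(j+1) (j+1)). *)
Lemma dyadic_sum_ge j : (0 < j)%N ->
  (2 * j.+1%:R)^-1 <= \sum_(2 ^ j <= n < 2 ^ j.+1) (n%:R * log n)^-1.
Proof.
move=> j0; apply: (@le_trans _ _
  (\sum_(2 ^ j <= n < 2 ^ j.+1) ((2 ^ j.+1)%:R * j.+1%:R : R)^-1)).
  have -> : \sum_(2 ^ j <= n < 2 ^ j.+1) ((2 ^ j.+1)%:R * j.+1%:R : R)^-1 =
      (2 ^ j)%:R * (2 * (2 ^ j)%:R * j.+1%:R)^-1.
    by rewrite sumr_const_nat -[LHS]mulr_natl expnS natrM mul2n -addnn addnK.
  have : (2 ^ j)%:R != 0 :> R by rewrite pnatr_eq0 expn_eq0.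
  have : j.+1%:R != 0 :> R by rewrite pnatr_eq0.
  move: ((2 ^ j)%:R : R) (j.+1%:R : R) => x y y0 x0.
  rewrite le_eqVlt; apply/orP; left; apply/eqP; by field; rewrite y0 x0.
apply: ler_sum_nat => n /andP[jn nj].
have n0 : (0 < n)%N by rewrite (leq_trans _ jn) ?expn_gt0.
have logn : 0 < log n.
  by apply: lt_le_trans (ler_log2 _ jn); rewrite ?log2_exp ?ltr0n ?expn_gt0.
rewrite lef_pV2; last 2 first.
- by rewrite posrE mulr_gt0// ltr0n.
- by rewrite posrE mulr_gt0// ltr0n ?expn_gt0.
apply: ler_pM; rewrite ?ler0n ?(ltW logn)//; first by rewrite ler_nat ltnW.
by rewrite -(log2_exp j.+1) ler_log2// ltnW.
Qed.

(** Second condensation: the block consists of 2^k dyadic ranges, each contributing at least 1 / (2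
    * 2^(k+1)). *)
Lemma block_sum_ge k :
  4^-1 <= \sum_(2 ^ 2 ^ k <= n < 2 ^ 2 ^ k.+1) (n%:R * log n)^-1.
Proof.
(* The fixed bound [L] keeps the denominator constant in the induction on the number [m] of dyadic
   ranges. *)
have h j L m : (0 < j)%N -> (j + m <= L)%N ->
    m%:R / (2 * L%:R) <= \sum_(2 ^ j <= n < 2 ^ (j + m)) (n%:R * log n)^-1.
  move=> j0; elim: m => [|m IH] jmL; first by rewrite mul0r addn0 big_geq.
  rewrite (@big_cat_nat _ _ _ (2 ^ (j + m)))//=; last 2 first.
  - by rewrite leq_exp2l// leq_addr.
  - by rewrite leq_exp2l// leq_add2l.
  rewrite -addn1 natrD mulrDl lerD ?IH//.
    by rewrite (leq_trans _ jmL)// leq_add2l.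
  rewrite addnA addn1; apply: le_trans (dyadic_sum_ge _); last first.
    by rewrite addn_gt0 j0.
  rewrite mul1r lef_pV2 ?posrE ?mulr_gt0 ?ltr0n//; last first.
    by rewrite (leq_trans _ jmL)// addnS.
  by rewrite ler_pM2l// ler_nat -addnS.
have := h (2 ^ k)%N (2 ^ k.+1)%N (2 ^ k)%N.
rewrite expn_gt0 addnn -mul2n -expnS => /(_ isT (leqnn _)).
apply: le_trans; rewrite expnS natrM.
have : (2 ^ k)%:R != 0 :> R by rewrite pnatr_eq0 expn_eq0.
move: ((2 ^ k)%:R : R) => x x0.
by rewrite le_eqVlt; apply/orP; left; apply/eqP; field.
Qed.

Context (omega : nat -> R).
Hypothesis omega_gt0 : forall n, (0 < n)%N -> 0 < omega n.
Hypothesis omega_nd :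
  forall m n, (0 < m)%N -> (m <= n)%N -> omega m <= omega n.
Local Notation w k := (omega (2 ^ 2 ^ k)).

Lemma blocks_sum_le (f : nat -> R) (g : nat -> R) K :
  (forall k, g k <= \sum_(2 ^ 2 ^ k <= n < 2 ^ 2 ^ k.+1) f n) ->
  \sum_(k < K) g k <= \sum_(2 <= n < 2 ^ 2 ^ K) f n.
Proof.
move=> gf; elim: K => [|K IH]; first by rewrite big_ord0 big_geq.
rewrite big_ord_recr (@big_cat_nat _ _ _ (2 ^ 2 ^ K))//= ?lerD//.
  by rewrite -{1}(expn1 2) leq_exp2l// expn_gt0.
by rewrite !leq_exp2l.
Qed.

(** The index is [k.+1] because [omega n] is bounded above on block [k] by the weight of the next
    block. The 4 inverts the bound of [block_sum_ge]. *)
Lemma weights_sum_le K :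
  \sum_(k < K) (w k.+1)^-1 <=
  \sum_(2 <= n < 2 ^ 2 ^ K) 4 * (1 / (n%:R * log n * omega n)).
Proof.
apply: (blocks_sum_le (g := fun k => (w k.+1)^-1)) => k.
have w0 : 0 < w k.+1 by rewrite omega_gt0// expn_gt0.
have := block_sum_ge k; rewrite -(ler_pM2l (x := 4 * (w k.+1)^-1)); last first.
  by rewrite mulr_gt0// invr_gt0.
rewrite mulrAC divff// mul1r => /le_trans; apply.
rewrite mulr_sumr; apply: ler_sum_nat => n /andP[kn nk].
have n1 : (1 < n)%N by rewrite (leq_trans _ kn)// -{1}(expn1 2) leq_exp2l// expn_gt0.
have logn : 0 < log n.
  by apply: lt_le_trans (ler_log2 _ n1) => //; rewrite -(expn1 2) log2_exp.
rewrite div1r -[leLHS]mulrA ler_pM2l// [leLHS]mulrC [leRHS]invfM ler_pM2l; last first.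
  by rewrite invr_gt0 mulr_gt0 // ltr0n ltnW.
have n0 : (0 < n)%N by exact: ltnW.
rewrite lef_pV2 ?posrE ?omega_gt0 ?expn_gt0//.
by apply: omega_nd => //; exact: ltnW.
Qed.

Lemma coefs_sum_le (b : nat -> R) K : (forall n, 0 <= b n) ->
  \sum_(k < K) w k * (2 ^ k.+1).+1%:R ^+ 2 *
     (\sum_(2 ^ 2 ^ k <= n < 2 ^ 2 ^ k.+1) b n) <=
  \sum_(2 <= n < 2 ^ 2 ^ K) 9 * (b n * log n ^+ 2 * omega n).
Proof.
move=> b0; apply: (blocks_sum_le (g := fun k => w k * (2 ^ k.+1).+1%:R ^+ 2 *
     (\sum_(2 ^ 2 ^ k <= n < 2 ^ 2 ^ k.+1) b n))) => k.
rewrite mulr_sumr; apply: ler_sum_nat => n /andP[kn nk].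
have kgt0 : (0 < 2 ^ 2 ^ k)%N by rewrite expn_gt0.
have kw : w k <= omega n by rewrite omega_nd.
have w0 : 0 < w k by rewrite omega_gt0.
have kl : (2 ^ k)%:R <= log n by rewrite -(log2_exp (2 ^ k)) ler_log2.
have e1 : 1 <= (2 ^ k)%:R :> R by rewrite ler1n expn_gt0.
have bn := b0 n.
(* Since 1 <= 2^k <= log2 n, one has 2^(k+1) + 1 <= 3 * 2^k <= 3 log2 n. *)
have h : (2 ^ k.+1).+1%:R ^+ 2 <= 9 * log n ^+ 2.
  rewrite -natr1 expnS natrM.
  move: ((2 ^ k)%:R : R) (log n) kl e1 => x y; nra.
rewrite [leRHS](_ : _ = omega n * (9 * log n ^+ 2) * b n); last by ring.
by rewrite ler_wpM2r// ler_pM// ?sqr_ge0// ltW.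
Qed.

End double_exponential_blocks.

(** * Permuted series *)

Section cauchy_criteria.
Context (R : realType).

Lemma sum_uniq_sub (I : eqType) (b : I -> R) (s t : seq I) :
  (forall i, 0 <= b i) -> uniq s -> {subset s <= t} ->
  \sum_(i <- s) b i <= \sum_(i <- t) b i.
Proof.
move=> b0; elim: s t => [|i s IH] t /=; first by rewrite big_nil sumr_ge0.
move=> /andP[is' us] st; have it : i \in t by apply: st; rewrite inE eqxx.
rewrite (perm_big _ (perm_to_rem it)) !big_cons lerD2l; apply: IH => // j js.
have := st j; rewrite inE js orbT (perm_mem (perm_to_rem it)) inE.
by move=> /(_ isT)/orP[/eqP ji|//]; rewrite -ji js in is'.
Qed.

(** [K0] is chosen so that its partial sum exceeds the supremum of all partial sums minus [e]. *)
Lemma bounded_sum_tail (c : nat -> R) (B : R) : (forall k, 0 <= c k) ->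
  (forall K, \sum_(k < K) c k <= B) ->
  forall e, 0 < e -> exists K0, forall K, \sum_(K0 <= k < K) c k < e.
Proof.
move=> c0 cB e e0; pose S := [set \sum_(k < K) c k | K in setT].
have hS : has_sup S.
  split; first by exists (\sum_(k < 0) c k), 0%N.
  by exists B => _ [K _ <-].
have [_ [K0 _ <-] h] := sup_adherent e0 hS; exists K0 => K.
have [KK0|K0K] := leqP K K0; first by rewrite big_geq.
have : \sum_(k < K) c k <= sup S by apply: ub_le_sup; [exact: hS.2|exists K].
rewrite -!(big_mkord xpredT c) in h *.
by rewrite (big_cat_nat (n := K0)) ?(ltnW K0K)//=; lra.
Qed.

Lemma rnorm_cauchy_cvg (k : scalar_kind)
    (V : completeNormedModType (scalarField R k)) (u : nat -> V) :
  (forall e : R, 0 < e -> exists N, forall m n, (N <= m)%N -> (m <= n)%N ->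
    rnorm (u n - u m) < e) -> cvgn u.
Proof.
move=> hu; apply/cauchy_cvgP/cauchyP => e e0.
have [N hN] := hu _ (sRe_gt0 e0); exists (u N); exists N => // n /= Nn.
rewrite -ball_normE /ball_/= distrC; apply: rnorm_lt => //.
exact: hN.
Qed.

Lemma nneseries_bounded (f : nat -> R) m : (forall n, (m <= n)%N -> 0 <= f n) ->
  (\sum_(m <= n <oo) (f n)%:E < +oo)%E ->
  exists B, forall N, \sum_(m <= n < N) f n <= B.
Proof.
move=> f0 foo; exists (fine (\sum_(m <= n <oo) (f n)%:E)%E) => N.
rewrite -lee_fin fineK; last first.
  by rewrite ge0_fin_numE//; apply: nneseries_ge0 => n mn _; rewrite lee_fin f0.
rewrite -sumEFin; apply: nneseries_lim_ge => n mn _.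
by rewrite lee_fin f0.
Qed.

End cauchy_criteria.

Section permutations.
Context (sigma : nat -> nat).
Hypothesis sigma_bij :
  set_bij [set n | (0 < n)%N] [set n | (0 < n)%N] sigma.

Lemma sigma_gt0 j : (0 < j)%N -> (0 < sigma j)%N.
Proof. by case: sigma_bij => h _ _; exact: h. Qed.

Lemma sigma_inj i j : (0 < i)%N -> (0 < j)%N -> sigma i = sigma j -> i = j.
Proof. by case: sigma_bij => _ h _ i0 j0; apply: h; rewrite inE. Qed.

Lemma sigma_bounded_preimages M : exists N, forall n, (0 < n)%N -> (n < M)%N ->
  exists j, [/\ (0 < j)%N, (j <= N)%N & sigma j = n].
Proof.
elim: M => [|M [N hN]]; first by exists 0%N.
have [->|M0] := posnP M; first by exists 0%N => -[].
have [_ _ /(_ M M0)[j /= j0 jM]] := sigma_bij.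
exists (maxn N j) => n n0; rewrite ltnS leq_eqVlt => /orP[/eqP ->|nM].
  by exists j; rewrite leq_maxr.
have [i [i0 iN iE]] := hN n n0 nM; exists i; split => //.
by rewrite leq_max iN.
Qed.

(** Filtering keeps the permuted order, so for fixed [k] these lists are prefixes of one another as
    [m] grows. *)
Definition block_prefix (k m : nat) : seq nat :=
  [seq n <- map sigma (iota 1 m) | block n == k].

Lemma block_prefix_gt0 k m : all (leq 1) (block_prefix k m).
Proof.
apply/allP => n; rewrite mem_filter => /andP[_ /mapP[j]].
by rewrite mem_iota => /andP[j0 _] ->; exact: sigma_gt0.
Qed.

Lemma block_prefix_uniq k m : uniq (block_prefix k m).
Proof.
rewrite filter_uniq// map_inj_in_uniq ?iota_uniq// => i j.
by rewrite !mem_iota => /andP[i0 _] /andP[j0 _]; exact: sigma_inj.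
Qed.

Lemma mem_block_prefix k m n : n \in block_prefix k m ->
  [/\ (0 < n)%N, block n = k & (n < 2 ^ 2 ^ k.+1)%N].
Proof.
move=> nB; have n0 := allP (block_prefix_gt0 k m) _ nB.
move: nB; rewrite mem_filter => /andP[/eqP nk _]; split => //.
by have /andP[+ _] := block_bounds n0; rewrite nk.
Qed.

Lemma size_block_prefix k m : (size (block_prefix k m) <= 2 ^ 2 ^ k.+1)%N.
Proof.
rewrite -[leqRHS](size_iota 0); apply: uniq_leq_size.
  exact: block_prefix_uniq.
by move=> n /mem_block_prefix[_ _ nk]; rewrite mem_iota.
Qed.

(** A block is finite, so the first [N] places of the permutation exhaust it; by injectivity none of
    its indices occurs later. *)
Lemma block_prefix_stable k : exists N, forall m,
  (exists i, block_prefix k m = take i (block_prefix k N)) /\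
  ((N <= m)%N -> block_prefix k m = block_prefix k N).
Proof.
have [N hN] := sigma_bounded_preimages (2 ^ 2 ^ k.+1); exists N => m.
have st : (N <= m)%N -> block_prefix k m = block_prefix k N.
  move=> Nm; rewrite /block_prefix -(subnKC Nm) iotaD map_cat filter_cat.
  rewrite [X in _ ++ X](_ : _ = [::]) ?cats0//.
  apply/eqP; rewrite -size_eq0 size_filter -leqn0 leqNgt -has_count.
  apply/hasPn => n /mapP[j]; rewrite mem_iota => /andP[Nj _] jn.
  have j0 : (0 < j)%N by rewrite (leq_trans _ Nj).
  apply/eqP => nk; have n0 : (0 < n)%N by rewrite jn sigma_gt0.
  have /andP[nlt _] := block_bounds n0; rewrite nk in nlt.
  have [i [i0 iN ij]] := hN n n0 nlt.
  have ijE : i = j by apply: sigma_inj => //; rewrite ij.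
  by move: Nj; rewrite add1n ltnNge -ijE iN.
split => //; have [Nm|mN] := leqP N m.
  by exists (size (block_prefix k N)); rewrite take_size st.
exists (size (block_prefix k m)).
rewrite /block_prefix -(subnKC (ltnW mN)) iotaD map_cat filter_cat.
by rewrite take_size_cat.
Qed.

(** The extra term accounts for the index 1, which belongs to block 0 but lies below 2^2^0 = 2. *)
Lemma block_prefix_sum_le (R : realType) (b : nat -> R) k m : (forall n, 0 <= b n) ->
  \sum_(n <- block_prefix k m) b n <=
  \sum_(2 ^ 2 ^ k <= n < 2 ^ 2 ^ k.+1) b n + (k == 0)%:R * b 1.
Proof.
move=> b0; have -> : (k == 0)%:R * b 1 = \sum_(n <- nseq (k == 0) 1%N) b n.
  by case: eqP => _; rewrite /= ?big_nil ?big_seq1 ?mul1r ?mul0r.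
rewrite -big_cat; apply: sum_uniq_sub => //; first exact: block_prefix_uniq.
move=> n /mem_block_prefix[n0 nk nlt]; rewrite mem_cat mem_index_iota nlt andbT.
have [n1|n1] := leqP n 1.
  have {}n1 : n = 1%N by apply/eqP; rewrite eqn_leq n1.
  by rewrite -nk n1 orbT.
by have /andP[_ /implyP/(_ n1)] := block_bounds n0; rewrite nk => ->.
Qed.

End permutations.

Section blocks_of_series.
Context (R : realType) (k : scalar_kind) (d : measure_display)
  (X : measurableType d)
  (H : X -> hilbertSpace R k) (phi : nat -> forall x, H x)
  (a : nat -> scalarField R k).

Lemma psum_blocks s x K : all (fun n => (block n < K)%N) s ->
  psum phi a s x = \sum_(i < K) psum phi a [seq n <- s | block n == i] x.
Proof.
elim: s => [_|n s IH /= /andP[nK /IH sK]].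
  by rewrite /psum big_nil big1// => i _; rewrite big_nil.
rewrite -cat1s psum_cat sK (bigD1 (Ordinal nK))//= [in RHS](bigD1 (Ordinal nK))//=.
rewrite eqxx -[n :: [seq _ <- _ | _]]cat1s psum_cat addrA; congr (_ + _).
by apply: eq_bigr => i; rewrite -val_eqE/= eq_sym => /negbTE ->.
Qed.

(** The factor 2 lets [c i] bound the difference of any two partial sums of block [i], so the Cauchy
    criterion follows from the tails of [c]. *)
Lemma permuted_sum_cvg (sigma : nat -> nat) (x : X) (c : nat -> R) (B : R) :
  set_bij [set n | (0 < n)%N] [set n | (0 < n)%N] sigma ->
  (forall i K, 2 * rnorm (psum phi a (block_prefix sigma i K) x) <= c i) ->
  (forall K, \sum_(i < K) c i <= B) ->
  cvgn (fun N => \sum_(1 <= n < N.+1) a (sigma n) *: phi (sigma n) x).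
Proof.
move=> sigma_bij Pc cB.
have c0 i : 0 <= c i.
  by apply: le_trans (Pc i 0%N); rewrite mulr_ge0// rnorm_ge0.
have /choice[N hN] := block_prefix_stable sigma_bij.
rewrite (_ : (fun _ => _) =
    fun m => psum phi a (map sigma (iota 1 m)) x); last first.
  by apply/funext => m; rewrite /psum big_map /index_iota subSS subn0.
apply: rnorm_cauchy_cvg => e e0.
have [K0 hK0] := bounded_sum_tail c0 cB e0.
(* From this place on, the blocks below [K0] are complete and cancel in differences. *)
exists (\max_(i < K0) N i) => m m' Nm mm'.
(* [K] exceeds every block met by the first [m'] terms and is at least [K0], so that the sum can be
   split there. *)
pose K := (maxn K0 (\max_(n <- map sigma (iota 1 m')) block n).+1).
have hK s : {subset s <= map sigma (iota 1 m')} -> all (fun n => (block n < K)%N) s.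
  move=> sub; apply/allP => n /sub ns; rewrite leq_max ltnS; apply/orP; right.
  exact: leq_bigmax_seq.
rewrite (@psum_blocks _ _ K (hK _ _))//.
rewrite (@psum_blocks _ _ K (hK _ _)); last first.
  move=> n /mapP[j jm ->]; apply: map_f; move: jm; rewrite !mem_iota.
  by move=> /andP[-> jm]; rewrite (leq_trans jm)// leq_add2l.
rewrite -sumrB; apply: le_lt_trans (hK0 K).
apply: le_trans (rnorm_sum _ _ _) _.
rewrite -(big_mkord xpredT (fun i => rnorm (psum phi a (block_prefix sigma i m') x -
  psum phi a (block_prefix sigma i m) x))).
rewrite (big_cat_nat (n := K0)) ?leq_maxl//= [X in X + _]big_nat_cond big1 ?add0r.
  apply: ler_sum_nat => i _.
  have := ler_rnormD (psum phi a (block_prefix sigma i m') x)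
    (- psum phi a (block_prefix sigma i m) x).
  have := Pc i m; have := Pc i m'.
  have -> : rnorm (- psum phi a (block_prefix sigma i m) x) =
    rnorm (psum phi a (block_prefix sigma i m) x) by rewrite /rnorm normrN.
  by lra.
move=> i; rewrite andbT => /andP[_ iK0].
have Nim : (N i <= m)%N.
  apply: leq_trans Nm.
  exact: (@leq_bigmax _ (fun i : 'I_K0 => N i) (Ordinal iK0)).
have [_ ->] := hN i m'; last exact: leq_trans mm'.
by have [_ ->] := hN i m => //; rewrite subrr rnorm0.
Qed.

End blocks_of_series.

(** * Almost everywhere summability of the block bounds *)

Lemma weight_amgm (R : realType) (y w M : R) :
  0 < w -> y ^+ 2 <= M -> 2 * y <= w * M + w^-1.
Proof.
move=> w0 yM; rewrite -(ler_pM2l w0) mulrDr divff ?gt_eqF//.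
(* After multiplication by [w], the claim is 2 w y <= w^2 M + 1, which follows from this square. *)
have h1 := sqr_ge0 (w * y - 1).
have h2 : 0 <= w * w * (M - y ^+ 2) by rewrite mulr_ge0 ?subr_ge0// mulr_ge0// ltW.
by lra.
Qed.

(** Monotone convergence makes the sum of the series integrable, hence finite almost everywhere. *)
Lemma nneseries_ae_bounded (R : realType) (d : measure_display)
    (X : measurableType d) (mu : {measure set X -> \bar R}) (D : set X)
    (f : nat -> X -> R) (B : R) :
  measurable D -> (forall k x, 0 <= f k x) ->
  (forall k, mu.-integrable D (EFin \o f k)) ->
  (forall K, \sum_(k < K) (\int[mu]_(x in D) (f k x)%:E) <= B%:E)%E ->
  {ae mu, forall x, D x -> exists C, forall K, \sum_(k < K) f k x <= C}.
Proof.
move=> mD f0 fi fB.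
have mf k : measurable_fun D (EFin \o f k) by exact: measurable_int (fi k).
have int_sum : mu.-integrable D (fun x => \sum_(0 <= k <oo) (f k x)%:E)%E.
  apply/integrableP; split.
    by apply: ge0_emeasurable_sum => [k x _ _|k _]; [rewrite lee_fin|exact: mf].
  rewrite (eq_integral (fun x => \sum_(0 <= k <oo) (f k x)%:E)%E); last first.
    move=> x _; rewrite gee0_abs//.
    by apply: nneseries_ge0 => k _ _; rewrite lee_fin.
  rewrite integral_nneseries//; last by move=> k x _; rewrite lee_fin.
  apply: (@le_lt_trans _ _ B%:E); last by rewrite ltry.
  apply: lime_le.
    by apply: is_cvg_nneseries => k _ _; apply: integral_ge0 => x _; rewrite lee_fin.
  by apply: nearW => K; rewrite big_mkord; exact: fB.
have := integrable_ae mD int_sum; apply: filterS => x /[apply] fx.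
have [|C hC] := @nneseries_bounded R (fun k => f k x) 0 (fun k _ => f0 k x).
  by rewrite -ge0_fin_numE//; apply: nneseries_ge0 => k _ _; rewrite lee_fin.
by exists C => K; have := hC K; rewrite big_mkord.
Qed.

Theorem theorem3 (R : realType) (k : scalar_kind) (d : measure_display)
    (X : measurableType d) (mu : {measure set X -> \bar R})
    (H : X -> hilbertSpace R k) (HM : measurable_collection mu H)
    (J : identification H)
    (phi : nat -> forall x, H x) (phi_on : orthonormal_system mu J phi)
    (a : nat -> scalarField R k) (omega : nat -> R)
    (omega_gt0 : forall n, (0 < n)%N -> 0 < omega n)
    (omega_nd : forall m n, (0 < m)%N -> (m <= n)%N -> omega m <= omega n)
    (a_omega : (\sum_(2 <= n <oo)
       (sRe `|a n| ^+ 2 * log2 (n%:R : R) ^+ 2 * omega n)%:E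
         < +oo)%E)
    (omega_log : (\sum_(2 <= n <oo)
       (1 / (n%:R * log2 (n%:R : R) * omega n))%:E < +oo)%E) :
  unconditionally_cvg_ae mu (fun n x => a n *: phi n x).
Proof.
move=> sigma sigma_bij.
have /choice[N hN] := block_prefix_stable sigma_bij.
pose b n := sRe `|a n| ^+ 2.
have b0 n : 0 <= b n by rewrite sqr_ge0.
pose w j := omega (2 ^ 2 ^ j)%N.
have w0 j : 0 < w j by rewrite omega_gt0// expn_gt0.
have log_ge0 n : (2 <= n)%N -> 0 <= log2 (n%:R : R).
  move=> n2; rewrite /log2 divr_ge0// ?ln_ge0 ?ler1n//.
  by rewrite (leq_trans _ n2).
have [A hA] : exists A, forall N, \sum_(2 <= n < N)
    (b n * log2 (n%:R : R) ^+ 2 * omega n) <= A.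
  apply: nneseries_bounded => // n n2.
  rewrite mulr_ge0 ?(ltW (omega_gt0 _ (ltnW n2)))//.
  by rewrite mulr_ge0 ?b0 ?sqr_ge0.
have [B hB] : exists B, forall N, \sum_(2 <= n < N)
    (1 / (n%:R * log2 (n%:R : R) * omega n)) <= B.
  apply: nneseries_bounded => // n n2.
  rewrite divr_ge0// mulr_ge0 ?(ltW (omega_gt0 _ (ltnW n2)))//.
  by rewrite mulr_ge0 ?log_ge0.
(* [s j] is the complete block [j] in permuted order; it has at most 2^(p j) elements. *)
pose s j := block_prefix sigma j (N j).
pose p j := (2 ^ j.+1)%N.
have [D cD hD] := rademacher_integral HM a phi_on.
(* Below, [f j] is w_j M_j, with M_j the bound of [rademacher_prefix] for all prefixes of [s j]. *)
have [mD _] := cD.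
pose f j x := w j * ((p j).+1%:R * rademacher phi a (p j) (s j) x).
have f0 j x : 0 <= f j x.
  by rewrite !mulr_ge0 ?rademacher_ge0// ltW.
have hf j : mu.-integrable D (EFin \o f j) /\ (\int[mu]_(x in D) (f j x)%:E
    = (w j * (p j).+1%:R ^+ 2 * \sum_(n <- s j) b n)%:E)%E.
  have [i1 e1] := hD (p j) (s j) (block_prefix_uniq sigma_bij _ _)
    (block_prefix_gt0 sigma_bij _ _).
  have -> : EFin \o f j =
      (fun x => (w j * (p j).+1%:R)%:E * (rademacher phi a (p j) (s j) x)%:E)%E.
    by apply/funext => x; rewrite /= -EFinM /f mulrA.
  split; first exact: integrableZl.
  rewrite (_ : (fun x => (f j x)%:E) =
      (fun x => (w j * (p j).+1%:R)%:E * (rademacher phi a (p j) (s j) x)%:E)%E).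
    by rewrite integralZl// e1 -EFinM; congr (_%:E); rewrite /b; ring.
  by apply/funext => x /=; rewrite -EFinM /f mulrA.
have f_bounded :
    {ae mu, forall x, D x -> exists C, forall K, \sum_(j < K) f j x <= C}.
  (* The second summand comes from the index 1 in block 0, where the factor is (p 0 + 1)^2 = 9. *)
  apply: (@nneseries_ae_bounded _ _ _ _ _ _ (9 * A + w 0%N * 9 * b 1%N)) => //.
    by move=> j; have [] := hf j.
  move=> K; under eq_bigr do rewrite (hf _).2; rewrite sumEFin lee_fin.
  apply: (@le_trans _ _ (\sum_(j < K) (w j * (p j).+1%:R ^+ 2 *
     (\sum_(2 ^ 2 ^ j <= n < 2 ^ 2 ^ j.+1) b n)) +
     \sum_(j < K) (w j * (p j).+1%:R ^+ 2 * ((j == 0 :> nat)%:R * b 1%N)))).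
    rewrite -big_split/=; apply: ler_sum => j _; rewrite -mulrDr ler_wpM2l//.
      by rewrite mulr_ge0 ?sqr_ge0// ltW.
    exact: block_prefix_sum_le.
  apply: lerD.
    apply: le_trans (coefs_sum_le omega_gt0 omega_nd _ b0) _.
    by rewrite -mulr_sumr ler_pM2l.
  case: K => [|K]; first by rewrite big_ord0 mulr_ge0 ?b0// mulr_ge0// ltW.
  rewrite big_ord_recl/= big1 => [|i _]; last by rewrite mul0r mulr0.
  by rewrite addr0 mul1r /p/= -natrX.
(* The weight of block 0 is split off because [weights_sum_le] starts with [w 1]. *)
have winv_bounded : forall K, \sum_(j < K) (w j)^-1 <= (w 0%N)^-1 + 4 * B.
  case=> [|K].
    rewrite big_ord0 addr_ge0 ?invr_ge0 ?(ltW (w0 _))// mulr_ge0//.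
    by have := hB 0%N; rewrite big_geq.
  rewrite big_ord_recl/= lerD2l.
  apply: le_trans (weights_sum_le omega_gt0 omega_nd K) _.
  by rewrite -mulr_sumr ler_pM2l.
have : {ae mu, forall x, D x} by exact: (conull_ae cD).
apply: filterS2 f_bounded => x /[swap] Dx /(_ Dx)[C hC].
apply: (@permuted_sum_cvg _ _ _ _ _ _ _ _ _ (fun j => f j x + (w j)^-1)
  (C + ((w 0%N)^-1 + 4 * B))) => //.
  move=> j m; apply: weight_amgm => //.
  (* Whatever [m] is, the terms of block [j] met so far form a prefix of [s j]. *)
  have [[i ->] _] := hN j m.
  by apply: rademacher_prefix; exact: size_block_prefix.
by move=> K; rewrite big_split lerD.
Qed.
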